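(* Let $G$ be a finite group with identity $e$, $R[G]$ its real group algebra, $S=\{x\in R[G]: \sum_gx_g=1,\ x_g\ge0\ \forall g\}$, and let $r>1$ be an integer. For $x\in S$ let $S_r(x)$ be the set of all limits of all convergent subsequences of $(x^{r^n})_{n\in\mathbb N}$, and let $d\ge1$ and distinct $m_0,\dots,m_{d-1}\in\{0,\dots,m_x-1\}$ be the repeating part of the eventually periodic sequence $(r^n \bmod m_x)_{n\in\mathbb N}$. Then: (1) $S_r(x)=\{c_xx^{m_i}: 0\le i<d\}=\{x^{m_i}c_x: 0\le i<d\}$; in particular $|S_r(x)|=1$ if and only if $m_x$ divides $r^k(r-1)$ for some $k\in\mathbb N$. (2) $\lim_{n\to\infty}\frac1n\sum_{i=1}^n x^{r^i}=\frac1d\sum_{i=0}^{d-1}x^{m_i}c_x$.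
   Context: $\mathrm{Supp}(y)=\{g: y_g\ne0\}$, $\mathbb N=\{1,2,\dots\}$, Euclidean topology on $R[G]$. For $x\in S$: $n_x=\min\{k\in\mathbb N:(x^k)_e\ne0\}$; $G_x$ is the subgroup of $G$ generated by $\mathrm{Supp}(x^{n_x})$; $c_x=\frac1{|G_x|}\sum_{g\in G_x}g$; $m_x=\min\{k\in\mathbb N:\mathrm{Supp}(x^k)\subset G_x\}$. *)

(* Defs.v *)
From HB Require Import structures.
From mathcomp Require Import all_boot all_order all_algebra all_fingroup.
From mathcomp Require Import all_classical all_reals all_analysis.
Set Implicit Arguments.
Unset Strict Implicit.
Unset Printing Implicit Defensive.
Import Order.TTheory GRing.Theory Num.Theory.
Import numFieldNormedType.Exports.
Local Open Scope ring_scope.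
Local Open Scope classical_set_scope.

Section GroupAlgebra.
Variables (R : realType) (gT : finGroupType).

(* The real group algebra R[G]: x is identified with its coefficient
   function g |-> x_g, i.e. x = \sum_g x_g g. *)
Notation galg := {ffun gT -> R}.

Definition ga_one : galg := [ffun g => (g == 1%g)%:R].

Definition ga_mul (x y : galg) : galg :=
  [ffun g => \sum_(h : gT) x h * y (h^-1 * g)%g].

Definition ga_exp (x : galg) (n : nat) : galg := iter n (ga_mul x) ga_one.

Definition supp (y : galg) : {set gT} := [set g | y g != 0].

Definition in_S (x : galg) : Prop := (forall g, 0 <= x g) /\ \sum_g x g = 1.

(* n_x = min{k in N : (x^k)_e <> 0}  (0 if no such k, which never
   happens for x in S) *)
Definition n_of (x : galg) : nat :=
  match pselect (exists k, (fun k => (0 < k)%N && (ga_exp x k 1%g != 0)) k) with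
  | left h => ex_minn h
  | right _ => 0%N
  end.

Definition G_of (x : galg) : {group gT} := <<supp (ga_exp x (n_of x))>>%G.

Definition c_of (x : galg) : galg :=
  [ffun g => if g \in G_of x then (#|G_of x|%:R)^-1 else 0].

(* m_x = min{k in N : Supp(x^k) \subset G_x}  (0 if none; never for x in S) *)
Definition m_of (x : galg) : nat :=
  match pselect (exists k, (fun k => (0 < k)%N &&
                     (supp (ga_exp x k) \subset G_of x)) k) with
  | left h => ex_minn h
  | right _ => 0%N
  end.

(* convergence in R[G] with its Euclidean topology (= coordinatewise) *)
Definition ga_cvg (u : nat -> galg) (l : galg) : Prop :=
  forall g, (fun n => u n g : R) @ \oo --> (l g : R).

(* S_r(x): limits of convergent subsequences of (x^{r^n})_{n in N},
   N = {1,2,...} *)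
Definition Sr (r : nat) (x : galg) : set galg :=
  [set y | exists phi : nat -> nat,
      (forall n, 0 < phi n)%N /\ (forall n, phi n < phi n.+1)%N /\
      ga_cvg (fun n => ga_exp x (r ^ phi n)) y].

End GroupAlgebra.

(* Main.v *)
(* Let G_x be the subgroup generated by the support of x^n, n = n_x.  Some power
   y = x^M has support exactly G_x, so by Doeblin's minorization y acts as a
   strict l^1-contraction on the elements killed by the idempotent c = c_x;
   hence x^t - x^t c -> 0.  As x^m c = c for m = m_x, the element x^t c depends
   only on t mod m, and minimality of m makes the m values distinct.  Thus
   x^(r^n) is asymptotic to the eventually periodic sequence x^(r^n mod m) c,
   from which the limit points and the Cesaro limit are read off. *)
Require Import Defs.
From HB Require Import structures.
From mathcomp Require Import all_boot all_order all_algebra all_fingroup.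
From mathcomp Require Import all_classical all_reals all_analysis.
Import Order.TTheory GRing.Theory Num.Theory.
Import numFieldNormedType.Exports.
Local Open Scope ring_scope.
Local Open Scope classical_set_scope.

(** * Convolution, supports and the convex set [S] *)

Section Algebra.
Context {R : realType} {gT : finGroupType}.
Implicit Types (x y z u : {ffun gT -> R}) (H : {group gT}).

Lemma ga_mulEr x y g : ga_mul x y g = \sum_k x (g * k^-1)%g * y k.
Proof.
rewrite ffunE (reindex_inj (h := fun k => (g * k^-1)%g)) /=.
  by apply: eq_bigr => k _; rewrite invMg invgK -mulgA mulVg mulg1.
by move=> k l /mulgI/invg_inj.
Qed.

Lemma ga_mulA x y z : ga_mul x (ga_mul y z) = ga_mul (ga_mul x y) z.
Proof.
apply/ffunP => g; rewrite ffunE [RHS]ga_mulEr.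
under eq_bigr => h _ do rewrite ga_mulEr mulr_sumr.
under [RHS]eq_bigr => k _ do rewrite ffunE mulr_suml.
rewrite exchange_big; apply: eq_bigr => k _; apply: eq_bigr => h _.
by rewrite mulrA mulgA.
Qed.

Lemma ga_mul1l x : ga_mul (ga_one R gT) x = x.
Proof.
apply/ffunP => g; rewrite ffunE (bigD1 1%g) //= big1 => [|h /negbTE h1].
  by rewrite ffunE eqxx mul1r invg1 mul1g addr0.
by rewrite ffunE h1 mul0r.
Qed.

Lemma ga_mulBl x y z : ga_mul (x - y) z = ga_mul x z - ga_mul y z.
Proof.
apply/ffunP => g; rewrite !ffunE -sumrB; apply: eq_bigr => h _.
by rewrite !ffunE mulrBl.
Qed.

Lemma ga_mulBr x y z : ga_mul x (y - z) = ga_mul x y - ga_mul x z.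
Proof.
apply/ffunP => g; rewrite !ffunE -sumrB; apply: eq_bigr => h _.
by rewrite !ffunE mulrBr.
Qed.

Lemma ga_expD x m n : ga_exp x (m + n) = ga_mul (ga_exp x m) (ga_exp x n).
Proof.
elim: m => [|m IH]; first by rewrite ga_mul1l.
by rewrite addSn /= -[LHS]/(ga_mul x (ga_exp x (m + n))) IH ga_mulA.
Qed.

Lemma ga_expM x m n : ga_exp x (m * n) = ga_exp (ga_exp x m) n.
Proof.
elim: n => [|n IH]; first by rewrite muln0.
by rewrite mulnS ga_expD IH.
Qed.

Lemma ga_mul_sum x y : \sum_g ga_mul x y g = (\sum_g x g) * (\sum_g y g).
Proof.
under eq_bigr => g _ do rewrite ga_mulEr.
rewrite exchange_big mulr_sumr; apply: eq_bigr => k _ /=.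
rewrite -mulr_suml (reindex_inj (mulIg k)) /=; congr (_ * _).
by apply: eq_bigr => g _; rewrite mulgK.
Qed.

Lemma ga_mul_ge0 x y :
  (forall g, 0 <= x g) -> (forall g, 0 <= y g) -> forall g, 0 <= ga_mul x y g.
Proof. by move=> x0 y0 g; rewrite ffunE sumr_ge0 // => h _; rewrite mulr_ge0. Qed.

Lemma ga_mul_gt0 x y h k :
  (forall g, 0 <= x g) -> (forall g, 0 <= y g) ->
  0 < x h -> 0 < y k -> 0 < ga_mul x y (h * k)%g.
Proof.
move=> x0 y0 xh yk; rewrite ffunE (bigD1 h) //= mulKg.
by rewrite ltr_pwDl ?mulr_gt0 ?sumr_ge0 // => l _; rewrite mulr_ge0.
Qed.

Lemma supp_mul_sub x y H :
  supp x \subset H -> supp y \subset H -> supp (ga_mul x y) \subset H.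
Proof.
move=> /fintype.subsetP xH /fintype.subsetP yH.
apply/fintype.subsetP => g; apply: contraLR => gH.
rewrite inE negbK ffunE big1 // => h _.
have [hx|] := boolP (h \in supp x); last by rewrite inE negbK => /eqP ->; rewrite mul0r.
have [hy|] := boolP ((h^-1 * g)%g \in supp y).
  by case/negP: gH; rewrite -(groupMl _ (groupVr (xH _ hx))) yH.
by rewrite inE negbK => /eqP ->; rewrite mulr0.
Qed.

Lemma supp_one_sub H : supp (ga_one R gT) \subset H.
Proof.
apply/fintype.subsetP => g; rewrite inE ffunE.
by have [->|_] := eqVneq g 1%g; rewrite ?group1 ?eqxx.
Qed.

Lemma supp_exp_sub x H n : supp x \subset H -> supp (ga_exp x n) \subset H.
Proof.
by move=> xH; elim: n => [|n IH]; [exact: supp_one_sub | exact: supp_mul_sub].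
Qed.

Lemma in_S_one : in_S (ga_one R gT).
Proof.
split=> [g|]; first by rewrite ffunE ler0n.
rewrite (bigD1 1%g) //= big1 => [|g /negbTE g1]; last by rewrite ffunE g1.
by rewrite ffunE eqxx addr0.
Qed.

Lemma in_S_mul x y : in_S x -> in_S y -> in_S (ga_mul x y).
Proof.
move=> [x0 x1] [y0 y1]; split; first exact: ga_mul_ge0.
by rewrite ga_mul_sum x1 y1 mulr1.
Qed.

Lemma in_S_exp x n : in_S x -> in_S (ga_exp x n).
Proof.
by move=> xS; elim: n => [|n IH]; [exact: in_S_one | exact: in_S_mul].
Qed.

Lemma in_supp x g : (forall g, 0 <= x g) -> (g \in supp x) = (0 < x g).
Proof. by move=> x0; rewrite inE lt0r x0 andbT. Qed.

Lemma exp_gt0 x g n : in_S x -> 0 < x g -> 0 < ga_exp x n (g ^+ n)%g.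
Proof.
move=> xS xg; elim: n => [|n IH]; first by rewrite ffunE expg0 eqxx ltr01.
rewrite expgS; apply: ga_mul_gt0 => //; first exact: (proj1 xS).
exact: (proj1 (in_S_exp _ n xS)).
Qed.

(** * The uniform idempotent of a subgroup *)

Definition ga_unif H : {ffun gT -> R} :=
  [ffun g => if g \in H then (#|H|%:R)^-1 else 0].

Lemma in_S_unif H : in_S (ga_unif H).
Proof.
split=> [g|]; first by rewrite ffunE; case: ifP; rewrite // invr_ge0 ler0n.
under eq_bigr => g _ do rewrite ffunE.
rewrite -big_mkcond sumr_const /= -[LHS]mulr_natl mulfV // pnatr_eq0 -lt0n.
exact: cardG_gt0.
Qed.

Lemma supp_unif H : supp (ga_unif H) \subset H.
Proof. by apply/fintype.subsetP => g; rewrite inE ffunE; case: ifP; rewrite ?eqxx. Qed.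

(** Translating [ga_unif H] by an element of [H] leaves it fixed, and the product is a combination
    of such translates with total weight 1. *)
Lemma mul_unifr x H : supp x \subset H -> \sum_g x g = 1 ->
  ga_mul x (ga_unif H) = ga_unif H.
Proof.
move=> /fintype.subsetP xH x1; apply/ffunP => g; rewrite ffunE.
rewrite -[RHS]mul1r -x1 mulr_suml; apply: eq_bigr => h _.
have [hx|] := boolP (h \in supp x); last by rewrite inE negbK => /eqP ->; rewrite !mul0r.
by rewrite !ffunE groupMl // groupV xH.
Qed.

Lemma mul_unifl x H : supp x \subset H -> \sum_g x g = 1 ->
  ga_mul (ga_unif H) x = ga_unif H.
Proof.
move=> /fintype.subsetP xH x1; apply/ffunP => g; rewrite ga_mulEr.
rewrite -[RHS]mulr1 -x1 mulr_sumr; apply: eq_bigr => h _.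
have [hx|] := boolP (h \in supp x); last by rewrite inE negbK => /eqP ->; rewrite !mulr0.
by rewrite !ffunE groupMr // groupV xH.
Qed.

(* [supp (x * unif H)] is the product set [supp x * H]. *)
Lemma supp_of_mul_unif x H : in_S x ->
  supp (ga_mul x (ga_unif H)) \subset H -> supp x \subset H.
Proof.
move=> xS /fintype.subsetP xcH; have [c0 _] := in_S_unif H.
apply/fintype.subsetP => g; rewrite in_supp => [xg|]; last exact: (proj1 xS).
apply: xcH; rewrite in_supp; last exact: ga_mul_ge0 (proj1 xS) c0.
rewrite -[g]mulg1; apply: ga_mul_gt0 (proj1 xS) c0 xg _.
by rewrite ffunE group1 invr_gt0 ltr0n cardG_gt0.
Qed.

(** * The l^1 norm and Doeblin contraction *)

Definition l1norm u : R := \sum_g `|u g|.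

Lemma l1norm_ge0 u : 0 <= l1norm u.
Proof. exact: sumr_ge0. Qed.

Lemma l1norm_le u g : `|u g| <= l1norm u.
Proof. by rewrite /l1norm (bigD1 g) //= lerDl sumr_ge0. Qed.

Lemma l1norm_eq0 u : l1norm u <= 0 -> u = 0.
Proof.
move=> u0; apply/ffunP => g; rewrite ffunE; apply/normr0_eq0/eqP.
by rewrite eq_le normr_ge0 andbT (le_trans (l1norm_le u g)).
Qed.

Lemma l1normD u y : l1norm (u + y) <= l1norm u + l1norm y.
Proof.
by rewrite -big_split; apply: ler_sum => g _; rewrite ffunE ler_normD.
Qed.

Lemma l1normN u : l1norm (- u) = l1norm u.
Proof. by apply: eq_bigr => g _; rewrite ffunE normrN. Qed.

Lemma l1norm_mul x u : l1norm (ga_mul x u) <= l1norm x * l1norm u.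
Proof.
have -> : l1norm x * l1norm u =
    \sum_g ga_mul [ffun g => `|x g|] [ffun g => `|u g|] g.
  by rewrite ga_mul_sum; congr (_ * _); apply: eq_bigr => g _; rewrite ffunE.
apply: ler_sum => g _; rewrite !ffunE (le_trans (ler_norm_sum _ _ _)) //.
by apply: ler_sum => h _; rewrite !ffunE normrM.
Qed.

Lemma l1norm_S x : in_S x -> l1norm x = 1.
Proof. by case=> x0 <-; apply: eq_bigr => g _; rewrite ger0_norm. Qed.

(* Doeblin minorization: [y] dominates [delta * unif H], and that part of [y]
   kills [u], so only mass [1 - delta] acts on [u]. *)
Lemma contract_unif y H : in_S y -> supp y = H :> {set gT} ->
  exists2 rho : R, 0 <= rho < 1 &
    forall u, ga_mul (ga_unif H) u = 0 -> l1norm (ga_mul y u) <= rho * l1norm u.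
Proof.
move=> [y0 y1] yH; case: (@arg_minP _ _ _ 1%g (mem H) y); first exact: group1.
move=> a aH amin; have ya : 0 < y a by rewrite -in_supp // yH.
pose c := ga_unif H; have [c0 c1] := in_S_unif H.
(* With this [delta], the function [delta * c] is constant on [H], equal to the minimum [y a] of [y]
   there, so [w] below is nonnegative. *)
pose delta := #|H|%:R * y a.
have H0 : #|H|%:R != 0 :> R by rewrite pnatr_eq0 -lt0n cardG_gt0.
pose w : {ffun gT -> R} := y - [ffun g => delta * c g].
have w0 g : 0 <= w g.
  rewrite /w !ffunE; case: ifP => gH; last by rewrite mulr0 subr0.
  by rewrite mulrAC mulfV // mul1r subr_ge0 amin.
have w1 : \sum_g w g = 1 - delta.
  rewrite -y1 -[delta]mulr1 -c1 mulr_sumr -sumrB.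
  by apply: eq_bigr => g _; rewrite !ffunE.
have nw : l1norm w = 1 - delta.
  by rewrite -w1; apply: eq_bigr => g _; rewrite ger0_norm.
(* Nonnegativity of [1 - delta] comes for free, since it is the norm of [w]. *)
exists (1 - delta) => [|u cu].
  rewrite -nw l1norm_ge0 nw ltrBlDr ltrDl mulr_gt0 //.
  by rewrite ltr0n cardG_gt0.
have -> : ga_mul y u = ga_mul w u; last by rewrite -nw l1norm_mul.
rewrite ga_mulBl (_ : ga_mul [ffun g => delta * c g] u = 0) ?subr0 //.
apply/ffunP => g; move/ffunP/(_ g): cu; rewrite !ffunE => cu.
under eq_bigr => h _ do rewrite ffunE -mulrA.
by rewrite -mulr_sumr cu mulr0.
Qed.

End Algebra.

(** * Powers of an element of [S] and their asymptotics *)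

Section Powers.
Context {R : realType} {gT : finGroupType} (x : {ffun gT -> R}).
Hypothesis xS : in_S x.

(** This unfolds to the same function as [c_of x], so facts about [c] apply to [c_of x] by
    conversion. *)
Let c := ga_unif (G_of x) : {ffun gT -> R}.

(** The minimum is over a nonempty set: if [x g > 0], the power of exponent [#[g]] charges the
    identity. The default 0 of [n_of] is thus excluded. *)
Lemma n_of_spec : (0 < n_of x)%N /\ 0 < ga_exp x (n_of x) 1%g.
Proof.
suff [n0 nx] : (0 < n_of x)%N /\ ga_exp x (n_of x) 1%g != 0.
  by split=> //; rewrite lt0r nx (proj1 (in_S_exp _ _ xS)).
rewrite /n_of; case: pselect => [h|[]]; first by case: ex_minnP => k /andP[].
have [g xg] : exists g, 0 < x g.
  apply/not_existsP => x_le0; have := oner_neq0 R; rewrite -(proj2 xS) big1 ?eqxx //.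
  move=> g _; apply/eqP; rewrite eq_le (proj1 xS) andbT leNgt.
  exact/negP/x_le0.
by exists #[g]%g; rewrite order_gt0 -(expg_order g) gt_eqF // exp_gt0.
Qed.

(* The identity lies in [A = supp (x ^ n_x)], so the supports of the powers of
   [x ^ n_x] increase, and they exhaust [<<A>>] since a finite group is
   generated by [A] as a monoid. *)
Lemma full_supp_exp :
  exists2 M, (0 < M)%N & supp (ga_exp x M) = G_of x :> {set gT}.
Proof.
have [n0 n1] := n_of_spec; set y := ga_exp x (n_of x) in n1.
have yS : in_S y by exact: in_S_exp.
have ykS k : in_S (ga_exp y k) by exact: in_S_exp.
have grow k l h : (k <= l)%N -> 0 < ga_exp y k h -> 0 < ga_exp y l h.
  move=> kl yh; rewrite -(subnK kl) ga_expD -[h]mul1g.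
  apply: ga_mul_gt0 => //; try exact: (proj1 (ykS _)).
  by rewrite -(expg1n gT (l - k)) exp_gt0.
have reach h : exists k, h \in G_of x -> 0 < ga_exp y k h.
  have [/gen_prodgP [k [a aA ->]]|_] := boolP (h \in G_of x); last by exists 0%N.
  exists k => _; elim: k a aA => [|k IH] a aA.
    by rewrite big_ord0 ffunE eqxx ltr01.
  rewrite big_ord_recl; apply: ga_mul_gt0; try exact: (proj1 yS).
  - exact: (proj1 (ykS _)).
  - by rewrite -in_supp ?aA //; exact: (proj1 yS).
  - exact: IH.
have {reach} [K KP] := fin_all_exists reach.
(* The maximum of the [K h] serves all [h] at once; the successor keeps the exponent positive. *)
exists (n_of x * (\max_h K h).+1)%N; first by rewrite muln_gt0 n0.
rewrite ga_expM -/y; apply/eqP; rewrite finset.eqEsubset; apply/andP; split.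
  by apply: supp_exp_sub; exact: subset_gen.
apply/fintype.subsetP => h hG; rewrite in_supp; last exact: (proj1 (ykS _)).
apply: grow (KP h hG); rewrite leqW //; exact: leq_bigmax.
Qed.

(** The exponent [n_of x] qualifies, as its support generates [G_of x]; so [m_of] is a genuine
    minimum. *)
Lemma m_of_spec : [/\ (0 < m_of x)%N, supp (ga_exp x (m_of x)) \subset G_of x &
  forall k, (0 < k)%N -> supp (ga_exp x k) \subset G_of x -> (m_of x <= k)%N].
Proof.
rewrite /m_of; case: pselect => [h|[]].
  case: ex_minnP => k /andP[k0 kG] kmin; split=> // l l0 lG.
  by apply: kmin; rewrite l0.
by exists (n_of x); rewrite (proj1 n_of_spec) subset_gen.
Qed.

Lemma exp_unif k : supp (ga_exp x k) \subset G_of x -> ga_mul (ga_exp x k) c = c.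
Proof. by move=> kG; apply: mul_unifr => //; exact: (proj2 (in_S_exp _ _ xS)). Qed.

Lemma unif_exp k : supp (ga_exp x k) \subset G_of x -> ga_mul c (ga_exp x k) = c.
Proof. by move=> kG; apply: mul_unifl => //; exact: (proj2 (in_S_exp _ _ xS)). Qed.

Lemma unif_idem : ga_mul c c = c.
Proof. apply: mul_unifr; [exact: supp_unif | exact: (proj2 (in_S_unif _))]. Qed.

(** Powers of [x^m] are supported in [G_of x], hence absorbed by [c]. *)
Lemma exp_unif_mod k : ga_mul (ga_exp x k) c = ga_mul (ga_exp x (k %% m_of x)) c.
Proof.
have [_ mG _] := m_of_spec.
rewrite {1}(divn_eq k (m_of x)) addnC ga_expD -ga_mulA exp_unif //.
by rewrite mulnC ga_expM supp_exp_sub.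
Qed.

(** For [a < b], multiplying by [x^(m-a)] turns the equality into [c = x^(b-a) c]. Then [x^(b-a)] is
    supported in [G_of x], against the minimality of [m]. *)
Lemma exp_unif_inj a b : (a < m_of x)%N -> (b < m_of x)%N ->
  ga_mul (ga_exp x a) c = ga_mul (ga_exp x b) c -> a = b.
Proof.
wlog ab : a b / (a <= b)%N => [hwlog am bm e|].
  by have [/hwlog|/ltnW/hwlog] := leqP a b; [exact | move=> h; symmetry; exact: h].
move=> am bm e; have [m0 mG mmin] := m_of_spec.
move: ab; rewrite leq_eqVlt => /predU1P[//|ab].
suff: (m_of x <= b - a)%N.
  by rewrite leqNgt (leq_ltn_trans (leq_subr _ _) bm).
apply: mmin; rewrite ?subn_gt0 //; apply: supp_of_mul_unif; first exact: in_S_exp.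
rewrite -/c -{1}(exp_unif _ mG) ga_mulA -ga_expD.
have -> : (b - a + m_of x = (m_of x - a) + b)%N.
  by rewrite addnC addnBA 1?ltnW // addnBAC // ltnW.
rewrite ga_expD -ga_mulA -e ga_mulA -ga_expD subnK 1?ltnW // exp_unif //.
exact: supp_unif.
Qed.

Lemma l1norm_exp_mul k u : l1norm (ga_mul (ga_exp x k) u) <= l1norm u.
Proof.
apply: le_trans (l1norm_mul _ _) _.
by rewrite l1norm_S ?mul1r //; exact: in_S_exp.
Qed.

(** Iterates the contraction by [x^M], where [x^M] has full support in [G_of x]: each [x^(Mq) - c]
    is killed by [c], and [x^M] maps it to the next one. *)
Lemma exp_sub_unif_small (eps : R) : 0 < eps ->
  exists T, supp (ga_exp x T) \subset G_of x /\ l1norm (ga_exp x T - c) < eps.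
Proof.
move=> eps0; have [M M0 MG] := full_supp_exp.
have [rho /andP[rho0 rho1] rhoP] := contract_unif _ _ (in_S_exp _ M xS) MG.
have qG q : supp (ga_exp x (M * q)) \subset G_of x.
  by rewrite ga_expM supp_exp_sub // MG.
have bound q : l1norm (ga_exp x (M * q) - c) <= rho ^+ q * l1norm (ga_one R gT - c).
  elim: q => [|q IH]; first by rewrite muln0 mul1r.
  have -> : ga_exp x (M * q.+1) - c = ga_mul (ga_exp x M) (ga_exp x (M * q) - c).
    by rewrite ga_mulBr -ga_expD -mulnS exp_unif // MG.
  rewrite exprS -mulrA; apply: le_trans (ler_wpM2l rho0 IH).
  by apply: rhoP; rewrite ga_mulBr unif_exp // unif_idem subrr.
have : (fun q => rho ^+ q * l1norm (ga_one R gT - c)) @ \oo --> (0 : R).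
  rewrite -(mul0r (l1norm (ga_one R gT - c))); apply: cvgMl.
  by apply: cvg_expr; rewrite ger0_norm.
move=> /cvgrPdist_lt/(_ _ eps0)[q _ /(_ q (leqnn q))] /=.
rewrite sub0r normrN => lt_eps; exists (M * q)%N; split=> //.
exact: le_lt_trans (bound q) (le_lt_trans (ler_norm _) lt_eps).
Qed.

(** For [t >= T] the difference is [x^(t-T) (x^T - c)], and multiplication by an element of [S] does
    not increase the norm. *)
Lemma exp_near_unif :
  (fun t => l1norm (ga_exp x t - ga_mul (ga_exp x t) c)) @ \oo --> (0 : R).
Proof.
apply/cvgrPdist_lt => eps eps0.
have [T [TG Teps]] := exp_sub_unif_small _ eps0.
exists T => // t /= Tt; rewrite sub0r normrN ger0_norm ?l1norm_ge0 //.
apply: le_lt_trans Teps; rewrite -(subnK Tt) ga_expD -ga_mulA exp_unif //.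
by rewrite -ga_mulBr l1norm_exp_mul.
Qed.

(* [c] is a limit of powers of [x], hence commutes with them. *)
Lemma unif_expC k : ga_mul c (ga_exp x k) = ga_mul (ga_exp x k) c.
Proof.
apply/eqP; rewrite -subr_eq0; apply/eqP/l1norm_eq0/ler_addgt0Pl => eps eps0.
rewrite addr0; have [T [_ /ltW Teps]] := exp_sub_unif_small _ (divr_gt0 eps0 (ltr0n R 2)).
set y := ga_exp x k.
(* Since [y] commutes with [x^T], the commutator with [c] is that with [c - x^T]; each of its two
   terms has norm at most [eps / 2]. *)
have -> : ga_mul c y - ga_mul y c =
    ga_mul y (ga_exp x T - c) - ga_mul (ga_exp x T - c) y.
  have yT : ga_mul y (ga_exp x T) = ga_mul (ga_exp x T) y.
    by rewrite /y -!ga_expD addnC.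
  by rewrite ga_mulBr ga_mulBl yT opprB [RHS]addrC addrA subrK.
rewrite [eps]splitr (le_trans (l1normD _ _)) // l1normN lerD //.
  by rewrite (le_trans (l1norm_exp_mul _ _)).
rewrite (le_trans (l1norm_mul _ _)) // [l1norm y]l1norm_S ?mulr1 //.
exact: in_S_exp.
Qed.

End Powers.

(** * Cesaro means of eventually periodic real sequences *)

Section PeriodicMean.
Context {R : realType} (b : nat -> R) (N d : nat).
Hypothesis d_gt0 : (0 < d)%N.
Hypothesis b_per : forall n, (N <= n)%N -> b (n + d)%N = b n.

Let L : R := d%:R^-1 * \sum_(i < d) b (N + i)%N.
Let w n := b n - L.

(** As [L] is the mean of [b] over one period, the centered terms of a period sum to zero. *)
Lemma series_centered_periodic n : (N <= n)%N -> series w (n + d)%N = series w n.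
Proof.
move=> Nn; rewrite -(subnKC Nn); elim: (n - N)%N => [|k IH]; last first.
  rewrite addnS addSn !seriesSr IH /w b_per //.
  exact: leq_addr.
rewrite addn0 !seriesEnat /= (@big_cat_nat _ _ _ N) ?leq_addr //=.
have -> : \sum_(N <= i < N + d) w i = \sum_(i < d) (b (N + i)%N - L).
  rewrite -{1}[N]add0n big_addn addKn big_mkord.
  by apply: eq_bigr => i _; rewrite addnC.
rewrite [X in _ + X]sumrB big_const_ord iter_addr_0 -[L *+ d]mulr_natl /L.
by rewrite mulrA mulfV ?mul1r ?subrr ?addr0 // pnatr_eq0 -lt0n.
Qed.

(** Subtracting [d] repeatedly brings [n] below [N + d]; the sum over that window crudely replaces a
    maximum. *)
Lemma series_centered_periodic_bounded n :
  `|series w n| <= \sum_(k < N + d) `|series w k|.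
Proof.
elim/ltn_ind: n => n IH; have [n_lt|n_ge] := ltnP n (N + d).
  by rewrite (bigD1 (Ordinal n_lt)) //= lerDl sumr_ge0.
have dn : (d <= n)%N by apply: leq_trans n_ge; rewrite leq_addl.
rewrite -(subnK dn) series_centered_periodic.
  by apply: IH; rewrite ltn_subrL d_gt0 (leq_trans d_gt0).
by rewrite leq_subRL // addnC.
Qed.

(** The mean of [b] is [L] plus the mean of [w], and the latter is a bounded partial sum times
    [1/(n+1)]. *)
Lemma mean_periodic : arithmetic_mean b @ \oo --> L.
Proof.
have meanE n : arithmetic_mean b n = arithmetic_mean w n + L.
  rewrite /arithmetic_mean /= !seriesEnat /= sumrB mulrBr !big_const_nat subn0.
  rewrite iter_addr_0 -[L *+ _]mulr_natl mulrA mulVf ?pnatr_eq0 // mul1r.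
  by rewrite subrK.
rewrite (_ : arithmetic_mean b = fun n => arithmetic_mean w n + L); last first.
  exact/funext.
rewrite -[X in _ --> X]add0r; apply: cvgD; last exact: cvg_cst.
pose B : R := \sum_(k < N + d) `|series w k|.
apply: norm_cvg0; apply: (@squeeze_cvgr _ _ _ _ (cst 0) (fun n => harmonic n * B)).
- apply: nearW => n; rewrite normr_ge0 /= normrM ger0_norm ?invr_ge0 ?ler0n //.
  by rewrite ler_wpM2l ?invr_ge0 ?ler0n // series_centered_periodic_bounded.
- exact: cvg_cst.
- by rewrite -[X in _ --> X](mul0r B); apply: cvgMl; exact: cvg_harmonic.
Qed.

Lemma mean_asymptotically_periodic (a : nat -> R) :
  (fun n => a n - b n) @ \oo --> (0 : R) -> arithmetic_mean a @ \oo --> L.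
Proof.
move=> /cesaro ab; rewrite -[X in _ --> X]add0r.
rewrite (_ : arithmetic_mean a =
    fun n => arithmetic_mean (fun n => a n - b n) n + arithmetic_mean b n).
  by apply: cvgD => //; exact: mean_periodic.
apply/funext => n; rewrite /arithmetic_mean /= -mulrDr; congr (_ * _).
by rewrite !seriesEnat /= -big_split; apply: eq_bigr => i _; rewrite /= subrK.
Qed.

End PeriodicMean.

(** * Subsequential limits of asymptotically periodic sequences *)

Section Sublimits.
Context {R : realType} {gT : finGroupType}.
Implicit Types (u p v : nat -> {ffun gT -> R}) (y : {ffun gT -> R}).

(** Finiteness of the group makes coordinatewise and norm convergence agree. *)
Lemma ga_cvgP v y : ga_cvg v y <-> (fun n => l1norm (v n - y)) @ \oo --> (0 : R).
Proof.
split=> [vy|vy g].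
  rewrite (_ : (0 : R) = \sum_(g : gT) 0); last by rewrite big1.
  apply: cvg_big => [|g _]; first exact: add_continuous.
  under eq_fun => n do rewrite !ffunE.
  by rewrite -(normr0 R) -(subrr (y g)); apply: cvg_norm; apply: cvgB (vy g) (cvg_cst _).
apply/cvgrPdist_lt => e e0; move/cvgrPdist_lt/(_ e e0): vy.
apply: filterS => n; rewrite sub0r normrN ger0_norm ?l1norm_ge0 //.
by apply: le_lt_trans; rewrite distrC (le_trans _ (l1norm_le _ g)) // !ffunE.
Qed.

Lemma increasing_cvg_oo (phi : nat -> nat) :
  (forall n, phi n < phi n.+1)%N -> phi @ \oo --> \oo.
Proof.
move=> phiS; have phi_ge n : (n <= phi n)%N.
  by elim: n => // n IH; exact: leq_ltn_trans (phiS n).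
move=> A [n _ nA]; exists n => // m /= nm.
by apply: nA => /=; exact: leq_trans (phi_ge m).
Qed.

Variables (u p : nat -> {ffun gT -> R}) (N d : nat).
Hypothesis N_gt0 : (0 < N)%N.
Hypothesis d_gt0 : (0 < d)%N.
Hypothesis p_per : forall n, (N <= n)%N -> p (n + d)%N = p n.
Hypothesis u_near_p : (fun n => l1norm (u n - p n)) @ \oo --> (0 : R).

Lemma periodic_from n k : (N <= n)%N -> p (n + k * d)%N = p n.
Proof.
move=> Nn; elim: k => [|k IH]; first by rewrite mul0n addn0.
by rewrite mulSn addnCA addnC p_per ?IH // (leq_trans Nn) ?leq_addr.
Qed.

Lemma periodic_values n : (N <= n)%N -> p n = p (N + (n - N) %% d)%N.
Proof.
move=> Nn; rewrite -{1}(subnKC Nn) {1}(divn_eq (n - N) d) addnCA addnC.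
by rewrite periodic_from // leq_addr.
Qed.

Lemma sublimits_asymptotically_periodic :
  [set y | exists phi : nat -> nat,
      (forall n, 0 < phi n)%N /\ (forall n, phi n < phi n.+1)%N /\
      ga_cvg (fun n => u (phi n)) y] =
  [set p (N + i)%N | i in [set i | (i < d)%N]].
Proof.
apply/seteqP; split=> y /=.
  move=> [phi [_ [/increasing_cvg_oo phi_oo /ga_cvgP uy]]].
  have up := cvg_comp _ _ phi_oo u_near_p.
  have dist_le n : l1norm (p (phi n) - y) <=
      l1norm (u (phi n) - p (phi n)) + l1norm (u (phi n) - y).
    rewrite -(l1normN (u _ - p _)) opprB (le_trans _ (l1normD _ _)) //.
    by rewrite addrA subrK.
  (* The periodic part takes finitely many values, so a nearest one to [y] exists. A positive
     minimal distance would contradict [p (phi n)] tending to [y]. *)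
  pose f (i : 'I_d) := l1norm (p (N + i)%N - y).
  have [i _ fmin] := @arg_minP _ _ _ (Ordinal d_gt0) predT f isT.
  have [fi0|fi_gt0] := lerP (f i) 0.
    by exists i => //; apply/eqP; rewrite -subr_eq0; apply/eqP/l1norm_eq0.
  have : (fun n =>
      l1norm (u (phi n) - p (phi n)) + l1norm (u (phi n) - y)) @ \oo --> (0 : R).
    by rewrite -[X in _ --> X](addr0 (0 : R)); exact: cvgD up uy.
  move=> /cvgrPdist_lt/(_ _ fi_gt0) small.
  have large : \forall n \near \oo, (N <= phi n)%N.
    by apply: (phi_oo [set k | (N <= k)%N]); exists N.
  have [n [Nn]] := filter_ex (filterI large small).
  rewrite sub0r normrN => /(le_lt_trans (ler_norm _))/(le_lt_trans (dist_le n)).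
  rewrite periodic_values // => /lt_geF.
  by rewrite -[X in _ <= X]/(f (Ordinal (ltn_pmod (phi n - N) d_gt0))) fmin.
(* Along this progression [p] is constant; [N > 0] makes all its indices positive. *)
move=> [i id <-]; exists (fun n => N + i + n * d)%N; split=> [n|].
  by rewrite -addnA (leq_trans N_gt0) ?leq_addr.
have phiS n : (N + i + n * d < N + i + n.+1 * d)%N.
  by rewrite ltn_add2l mulSn -[X in (X < _)%N]add0n ltn_add2r.
split=> //; apply/ga_cvgP; have := cvg_comp _ _ (increasing_cvg_oo _ phiS) u_near_p.
apply: cvg_trans; apply: near_eq_cvg; apply: nearW => n /=.
by rewrite periodic_from ?leq_addr.
Qed.

End Sublimits.

(** * Limit points and Cesaro limit of [x^(r^n)] *)

Lemma expn_eq_mod_dvd (m r n : nat) : (0 < r)%N ->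
  (r ^ n.+1 == r ^ n %[mod m])%N = (m %| r ^ n * (r - 1))%N.
Proof.
by move=> r0; rewrite eqn_mod_dvd ?leq_pexp2l // mulnBr muln1 -expnSr.
Qed.

Theorem theorem1 (R : realType) (gT : finGroupType) (r : nat)
    (x : {ffun gT -> R}) (N d : nat) :
  (1 < r)%N -> in_S x ->
  (* (r^n mod m_x) is periodic with period d from index N >= 1 on, and
     m_i := r^(N+i) mod m_x (i < d) are distinct: the repeating part *)
  (0 < N)%N -> (0 < d)%N ->
  (forall n, (N <= n)%N -> (r ^ (n + d) %% m_of x = r ^ n %% m_of x)%N) ->
  uniq [seq (r ^ (N + i) %% m_of x)%N | i <- iota 0 d] ->
  let m := fun i => (r ^ (N + i) %% m_of x)%N in
  (Sr r x = [set ga_mul (c_of x) (ga_exp x (m i)) | i in [set i | (i < d)%N]]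
   /\ Sr r x = [set ga_mul (ga_exp x (m i)) (c_of x) | i in [set i | (i < d)%N]]
   /\ ((exists y, Sr r x = [set y]) <->
       exists k, (0 < k)%N /\ (m_of x %| r ^ k * (r - 1))%N))
  /\ ga_cvg (fun n => [ffun g => (n.+1)%:R^-1 *
                         \sum_(1 <= i < n.+2) ga_exp x (r ^ i) g])
            [ffun g => d%:R^-1 *
                         \sum_(i < d) ga_mul (ga_exp x (m i)) (c_of x) g].
Proof.
move=> r_gt1 xS N_gt0 d_gt0 r_per _ m.
have r_gt0 : (0 < r)%N by exact: ltnW.
pose c := c_of x; pose u n := ga_exp x (r ^ n).
pose p n := ga_mul (ga_exp x (r ^ n %% m_of x)) c.
have p_per n : (N <= n)%N -> p (n + d)%N = p n by move=> /r_per e; rewrite /p e.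
have u_near_p : (fun n => l1norm (u n - p n)) @ \oo --> (0 : R).
  have pow_oo : (fun n => r ^ n)%N @ \oo --> \oo.
    by apply: increasing_cvg_oo => n; rewrite ltn_exp2l.
  apply: cvg_trans (cvg_comp _ _ pow_oo (exp_near_unif _ xS)).
  apply: near_eq_cvg; apply: nearW => n /=.
  by rewrite /u /p -exp_unif_mod.
have SrE : Sr r x = [set p (N + i)%N | i in [set i | (i < d)%N]].
  exact: sublimits_asymptotically_periodic u_near_p.
split; last first.
  move=> g; rewrite [X in _ --> X]ffunE.
  (* The required sum starts at [i = 1] while [arithmetic_mean] starts at index 0: hence the shift
     by one and the threshold [N.-1]. *)
  pose a n := u n.+1 g; pose b n := p n.+1 g.
  have b_per n : (N.-1 <= n)%N -> b (n + d)%N = b n.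
    by move=> Nn; rewrite /b -addSn p_per // -(prednK N_gt0).
  have ab : (fun n => a n - b n) @ \oo --> (0 : R).
    have /ga_cvgP/(_ g) : (fun n => l1norm (u n - p n - 0)) @ \oo --> (0 : R).
      by under eq_fun => n do rewrite subr0.
    rewrite ffunE -cvg_shiftS; apply: cvg_trans.
    by apply: near_eq_cvg; apply: nearW => n; rewrite /= [LHS]ffunE [X in _ + X]ffunE.
  have := mean_asymptotically_periodic b N.-1 d d_gt0 b_per a ab.
  rewrite (eq_bigr (fun i : 'I_d => p (N + i)%N g)); last first.
    by move=> i _; rewrite /b -addSn prednK.
  apply: cvg_trans; apply: near_eq_cvg; apply: nearW => n /=.
  by rewrite ffunE /arithmetic_mean /= seriesEnat /= big_add1.
split; [|split=> //].
  rewrite SrE; apply: eq_imagel => i _.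
  by rewrite [RHS]unif_expC.
have p_inj i j : p i = p j -> (r ^ i = r ^ j %[mod m_of x])%N.
  by have [m_gt0 _ _] := m_of_spec _ xS; apply: exp_unif_inj => //; rewrite ltn_mod.
have pSr n : (N <= n)%N -> Sr r x (p n).
  move=> Nn; rewrite SrE (periodic_values _ N d) //.
  by exists ((n - N) %% d)%N => //=; rewrite ltn_mod.
split=> [[y Sry]|[k [_ k_dvd]]].
  (* If there is one limit point, [p N] and [p N.+1] coincide, and injectivity gives equal
     residues. *)
  exists N; split=> //; rewrite -expn_eq_mod_dvd //; apply/eqP/p_inj.
  have Sr_y n : (N <= n)%N -> p n = y by move=> /pSr; rewrite Sry.
  by rewrite !Sr_y.
(* Divisibility at [k] persists for larger exponents, so the residues are constant from [k] on. *)
have r_const n : (k <= n)%N -> (r ^ n = r ^ k %[mod m_of x])%N.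
  move=> kn; rewrite -(subnKC kn); elim: (n - k)%N => [|l IH]; first by rewrite addn0.
  rewrite -IH addnS; apply/eqP; rewrite expn_eq_mod_dvd //.
  by rewrite expnD mulnAC dvdn_mulr.
(* Adding [k] periods moves the index past [k] without changing [p n], even when [N < k]. *)
have p_const n : (N <= n)%N -> p n = p k.
  move=> Nn; rewrite -(periodic_from p N d p_per n k Nn) /p r_const //.
  by rewrite (leq_trans _ (leq_addl _ _)) // leq_pmulr.
exists (p k); rewrite SrE; apply/seteqP; split=> z /=.
  by move=> [i _ <-]; rewrite p_const // leq_addr.
by move=> ->; exists 0%N; rewrite ?p_const // addn0.
Qed.
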